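(* Let $k\ge 3$ and $p=1+k+k(k-1)/2+k(k-1)(k-2)/6$. In the $k$-dimensional Poisson regression model with second-order interactions, let $\boldsymbol{\beta}$ have $\beta_0=0$, $\beta_1=\dots=\beta_k=-1$, $\beta_{ij}=0$ for all $1\le i<j\le k$, and $\beta_{ij\ell}=0$ for all $1\le i<j<\ell\le k$. Let $\mathbf{x}_0=(0,\dots,0)$, $\mathbf{x}_i=2\mathbf{e}_i$ for $i=1,\dots,k$ (where $\mathbf{e}_i$ is the $i$-th unit vector), $\mathbf{x}_{ij}=\mathbf{x}_i+\mathbf{x}_j$ for $1\le i<j\le k$, and $\mathbf{x}_{ij\ell}=\mathbf{x}_i+\mathbf{x}_j+\mathbf{x}_\ell$ for $1\le i<j<\ell\le k$. Then the design which assigns equal weights $1/p$ to these $p$ settings is locally $D$-optimal at $\boldsymbol{\beta}$ on $\mathcal{X}=[0,\infty)^k$.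
   Context: In the $k$-dimensional Poisson regression model with second-order interactions, an observation at $\mathbf{x}=(x_1,\dots,x_k)$ is Poisson distributed with mean $\lambda(\mathbf{x})=\exp(\mathbf{f}(\mathbf{x})^\top\boldsymbol{\beta})$, where $\mathbf{f}(\mathbf{x})$ consists of $1$, all $x_j$, all $x_ix_j$ ($i<j$) and all $x_ix_jx_\ell$ ($i<j<\ell$), so $\mathbf{f}(\mathbf{x})^\top\boldsymbol{\beta}=\beta_0+\sum_j\beta_jx_j+\sum_{i<j}\beta_{ij}x_ix_j+\sum_{i<j<\ell}\beta_{ij\ell}x_ix_jx_\ell$. A design $\xi$ is a finite collection of distinct settings $\mathbf{x}_i\in\mathcal{X}$ with weights $w_i\ge0$ summing to $1$; its information matrix is $\mathbf{M}_{\boldsymbol{\beta}}(\xi)=\sum_i w_i\lambda(\mathbf{x}_i)\mathbf{f}(\mathbf{x}_i)\mathbf{f}(\mathbf{x}_i)^\top$. A design is locally $D$-optimal at $\boldsymbol{\beta}$ on $\mathcal{X}$ if it maximizes $\det\mathbf{M}_{\boldsymbol{\beta}}(\xi)$ over all designs on $\mathcal{X}$. *)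

(* Defs.v *)
From HB Require Import structures.
From mathcomp Require Import all_boot all_order all_algebra.
From mathcomp Require Import reals sequences exp.
Set Implicit Arguments. Unset Strict Implicit. Unset Printing Implicit Defensive.
Import Order.TTheory GRing.Theory Num.Theory.
Local Open Scope ring_scope.

(* Index set of the regression terms: subsets S of {1..k} with |S| <= 3.
   S = {} <-> intercept, {j} <-> x_j, {i,j} <-> x_i x_j, {i,j,l} <-> x_i x_j x_l. *)
Definition Idx (k : nat) : finType := {S : {set 'I_k} | (#|S| <= 3)%N}.

(* number of parameters p = 1 + k + k(k-1)/2 + k(k-1)(k-2)/6 *)
Definition npar (k : nat) : nat := #|Idx k|.

Definition term {k : nat} (j : 'I_(npar k)) : {set 'I_k} := val (enum_val j).

Definition fvec {R : realType} {k : nat} (x : 'rV[R]_k) : 'cV[R]_(npar k) :=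
  \col_j \prod_(i in term j) x 0 i.

Definition intensity {R : realType} {k : nat} (beta : 'cV[R]_(npar k))
  (x : 'rV[R]_k) : R := expR (((fvec x)^T *m beta) 0 0).

Record design (R : realType) (k : nat) := Design {
  dsize : nat;
  dpt : 'I_dsize -> 'rV[R]_k;
  dw : 'I_dsize -> R }.
Arguments dsize {R k} d.
Arguments dpt {R k} d _.
Arguments dw {R k} d _.

Definition is_design_on {R : realType} {k : nat} (X : 'rV[R]_k -> Prop)
  (xi : design R k) : Prop :=
  [/\ injective (dpt xi), (forall i, 0 <= dw xi i),
      \sum_(i < dsize xi) dw xi i = 1 & (forall i, X (dpt xi i))].

Definition infomat {R : realType} {k : nat} (beta : 'cV[R]_(npar k))
  (xi : design R k) : 'M[R]_(npar k) :=
  \sum_(i < dsize xi) (dw xi i * intensity beta (dpt xi i)) *: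
      (fvec (dpt xi i) *m (fvec (dpt xi i))^T).

Definition locally_D_optimal {R : realType} {k : nat} (beta : 'cV[R]_(npar k))
  (X : 'rV[R]_k -> Prop) (xi : design R k) : Prop :=
  is_design_on X xi /\
  forall xi' : design R k, is_design_on X xi' ->
    \det (infomat beta xi') <= \det (infomat beta xi).

Definition nonneg_orthant {R : realType} {k : nat} (x : 'rV[R]_k) : Prop :=
  forall i, 0 <= x 0 i.

Definition beta6 (R : realType) (k : nat) : 'cV[R]_(npar k) :=
  \col_j (if #|term j| == 1%N then -1 else 0).

Definition design6 (R : realType) (k : nat) : design R k :=
  @Design R k (npar k)
    (fun j => \row_i (if i \in term j then 2 else 0))
    (fun _ => (npar k)%:R^-1).

(* Main.v *)
Require Import Defs.
From HB Require Import structures.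
From mathcomp Require Import classical_sets.
From mathcomp Require Import all_boot all_order all_algebra.
From mathcomp Require Import reals topology normedtype sequences derive exp.
From mathcomp Require Import ring lra.
Import Order.TTheory GRing.Theory Num.Theory.
Import numFieldNormedType.Exports.
Local Open Scope ring_scope.

(* With [K] the square matrix with columns [sqrt (lambda x_S) f(x_S)], every
   design on the orthant has information matrix [K N K^T], where [N] is a convex
   combination of matrices [v v^T]; the given design has [N = I/p].  Hadamard's
   inequality and AM-GM give [det N <= p^-p] as soon as all [|v| <= 1], i.e. for
   [y = x/2 >= 0],
     [sum_(|S| <= 3) e^(2|S|) L_S(y)^2 <= e^(2 sum y)],
   [L_S] being the Lagrange polynomials of the vertices [1_S].  If all but two
   coordinates of [y] and the sum of these two are fixed, the left-hand side is a
   strictly convex quadratic in their product.  Hence at a maximum over a simplex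
   [sum y = s] all nonzero coordinates coincide, and what remains is an
   inequality in their number [N] and common value [t].  For [N <= 3] it is the
   [N]-th power of [(1-t)^2 + e^2 t^2 <= e^(2t)]; for [N >= 4] it is not sharp
   and holds by explicit estimates. *)

(** * Lagrange polynomials and their Gram function *)

(** Subsets of [x |: D] either avoid [x] or arise from a subset of [D] by adjoining [x]. This split
    drives the recursions in [D] below. *)
Lemma sum_subsetU1 {V : nmodType} {I : finType} (P : pred {set I})
    (F : {set I} -> V) (x : I) (D : {set I}) : x \notin D ->
  \sum_(U : {set I} | (U \subset x |: D) && P U) F U =
  \sum_(U : {set I} | (U \subset D) && P U) F U +
  \sum_(U : {set I} | (U \subset D) && P (x |: U)) F (x |: U).
Proof.
move=> xD; rewrite (bigID (fun U : {set I} => x \in U)) /= addrC; congr (_ + _).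
  apply: eq_bigl => U; rewrite andbAC; congr (_ && _).
  apply/andP/idP => [[/subsetP UD xU]|UD]; last first.
    split; first exact: subset_trans UD (subsetUr _ _).
    by apply: contra xD; exact: (subsetP UD).
  apply/subsetP => i iU; have := UD _ iU; rewrite !inE.
  by case: eqP iU xU => [->->|].
rewrite (reindex_onto (fun U => x |: U) (fun U => U :\ x)) /=; last first.
  by move=> U /andP[_ xU]; rewrite setD1K.
apply: eq_bigl => U; rewrite setU11 andbT.
have [xU|xU] := boolP (x \in U).
  rewrite andbC; have /negbTE-> : (x |: U) :\ x != U.
    by apply/eqP => /setP/(_ x); rewrite !inE eqxx xU.
  by apply/esym/negbTE/nandP; left; apply: contra xD => /subsetP; apply.
rewrite setU1K // eqxx andbT; congr (_ && _).
apply/subsetP/subsetP => UD i iU; last first.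
  by move: iU; rewrite !inE => /orP[->//|/UD->]; rewrite orbT.
by have := UD i; rewrite !inE iU orbT => /(_ isT); case: eqP iU xU => [->->|].
Qed.

Section Gram.
Context {R : comPzRingType} {I : finType}.
Implicit Types (y : I -> R) (c : R) (D S : {set I}) (m n : nat).

(* [lag y m D S] is the Lagrange polynomial of the vertex [1_S] with respect to
   the monomials [y^U], [U \subset D], of degree less than [m], evaluated at [y]. *)
Definition lag y m D S : R :=
  \sum_(U : {set I} | (U \subset D) && ((S \subset U) && (#|U| < m)%N))
    (-1) ^+ (#|U| + #|S|) * \prod_(i in U) y i.

(** Weighted inner product of the Lagrange vectors for the degree bounds [m] and [n]. The target is
    [m = n = 4], [c = expR 2], but the recursion in [D] lowers the two bounds separately. *)
Definition gram c y m n D : R :=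
  \sum_(S : {set I} | S \subset D) c ^+ #|S| * lag y m D S * lag y n D S.

(** A set [U] containing [x] contributes [- y x] times the term of [U :\ x], whose degree bound is
    one lower. For [m = 0] all sums are empty, so the truncated [m.-1] is harmless. *)
Lemma lagU1_notin y m D S x : x \notin D -> S \subset D ->
  lag y m (x |: D) S = lag y m D S - y x * lag y m.-1 D S.
Proof.
move=> xD SD; rewrite /lag sum_subsetU1 //; congr (_ + _).
rewrite mulr_sumr -sumrN; apply: congr_big => // U.
  have [UD /=|//] := boolP (U \subset D).
  have xU : x \notin U by apply: contra xD; exact: (subsetP UD).
  rewrite cardsU1 xU add1n; congr (_ && _); last by case: m.
  apply/subsetP/subsetP => SU i iS; last by rewrite inE SU ?orbT.
  have := SU i iS; rewrite !inE; case: eqP => // ix _.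
  by move: xD; rewrite -ix (subsetP SD).
move=> /andP[UD _]; have xU : x \notin U by apply: contra xD; exact: (subsetP UD).
by rewrite cardsU1 xU big_setU1 //= add1n addSn exprS; ring.
Qed.

Lemma lagU1_in y m D S x : x \notin D -> S \subset D ->
  lag y m (x |: D) (x |: S) = y x * lag y m.-1 D S.
Proof.
move=> xD SD; rewrite /lag sum_subsetU1 // big1 ?add0r; last first.
  move=> U /andP[UD /andP[xSU _]]; case/negP: xD.
  by apply: (subsetP UD); apply: (subsetP xSU); rewrite setU11.
rewrite mulr_sumr; apply: congr_big => // U.
  have [UD /=|//] := boolP (U \subset D).
  have xU : x \notin U by apply: contra xD; exact: (subsetP UD).
  rewrite cardsU1 xU add1n; congr (_ && _); last by case: m.
  apply/idP/idP => [|SU]; last exact: setUS.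
  move=> /subsetP SU; apply/subsetP => i iS.
  have := SU i; rewrite !inE iS orbT => /(_ isT); case: eqP => // ix _.
  by move: xD; rewrite -ix (subsetP SD).
move=> /andP[UD _]; have xU : x \notin U by apply: contra xD; exact: (subsetP UD).
have xS : x \notin S by apply: contra xD; exact: (subsetP SD).
by rewrite !cardsU1 xU xS big_setU1 //= !add1n addSn addnS !exprS !mulN1r opprK mulrCA.
Qed.

(** With [L_m = lag y m D S], the set [S] contributes [(L_m - y_x L_(m-1)) (L_n - y_x L_(n-1))] and
    [x |: S] contributes [c y_x^2 L_(m-1) L_(n-1)]; hence the factor [1 + c]. *)
Lemma gramU1 c y m n D x : x \notin D ->
  gram c y m n (x |: D) = gram c y m n D
    - y x * (gram c y m.-1 n D + gram c y m n.-1 D)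
    + (1 + c) * y x ^+ 2 * gram c y m.-1 n.-1 D.
Proof.
move=> xD; rewrite /gram.
have := @sum_subsetU1 R I xpredT
  (fun S => c ^+ #|S| * lag y m (x |: D) S * lag y n (x |: D) S) x D xD.
under eq_bigl do rewrite andbT.
under [X in _ = X + _]eq_bigl do rewrite andbT.
under [X in _ = _ + X]eq_bigl do rewrite andbT.
move=> ->; rewrite mulrDr !mulr_sumr opprD -!sumrN -!big_split /=.
apply: eq_bigr => S SD.
have xS : x \notin S by apply: contra xD; exact: (subsetP SD).
rewrite !lagU1_in // !lagU1_notin // cardsU1 xS add1n exprS; ring.
Qed.

Lemma gram_mem0 c y n D : gram c y 0 n D = 0.
Proof.
by rewrite /gram big1 // => S _; rewrite {1}/lag big_pred0 ?mulr0 ?mul0r // => U; rewrite !andbF.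
Qed.

Lemma gramC c y m n D : gram c y m n D = gram c y n m D.
Proof. by apply: eq_bigr => S _; rewrite mulrAC. Qed.

Lemma gram_set0 c y m n : gram c y m.+1 n.+1 set0 = 1.
Proof.
have lag0 k : lag y k.+1 set0 set0 = 1.
  rewrite /lag (big_pred1 set0) => [|U].
    by rewrite big_set0 cards0 mulr1.
  rewrite subset0 sub0set /=; case: eqP => // ->; by rewrite cards0.
rewrite /gram (big_pred1 set0) => [|S]; last by rewrite subset0.
by rewrite !lag0 cards0 !mulr1.
Qed.

End Gram.

Lemma eq_gram {R : comPzRingType} {I : finType} (c : R) (y y' : I -> R) m n (D : {set I}) :
  {in D, y =1 y'} -> gram c y m n D = gram c y' m n D.
Proof.
move=> yy'.
have lagE k S : lag y k D S = lag y' k D S.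
  apply: eq_bigr => U /andP[UD _]; congr (_ * _); apply: eq_bigr => i iU.
  exact: yy' (subsetP UD _ iU).
by apply: eq_bigr => S _; rewrite !lagE.
Qed.

(** Two applications of the recursion. For a fixed sum [s] this is a quadratic in the product [u],
    strictly convex for [c > 0] by [gram22_gt0]. *)
Lemma gram_two {R : comPzRingType} {I : finType} (c : R) (y : I -> R) (D : {set I}) (i j : I) :
  i != j -> i \notin D -> j \notin D ->
  let s := y i + y j in let u := y i * y j in
  gram c y 4 4 (i |: (j |: D)) =
  gram c y 4 4 D - 2 * s * gram c y 3 4 D + (1 + c) * s ^+ 2 * gram c y 3 3 D
  + (2 * gram c y 2 4 D - 2 * c * gram c y 3 3 D
     - 2 * (1 + c) * s * gram c y 2 3 D) * u
  + (1 + c) ^+ 2 * gram c y 2 2 D * u ^+ 2.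
Proof.
move=> ij iD jD /=; rewrite !gramU1 ?inE ?negb_or ?ij //=.
rewrite (gramC c y 4 3) (gramC c y 4 2) (gramC c y 3 2); ring.
Qed.

Lemma finset_induction {I : finType} (P : {set I} -> Prop) :
  P set0 -> (forall x (D : {set I}), x \notin D -> P D -> P (x |: D)) -> forall D, P D.
Proof.
move=> P0 PU D; elim: {D}#|D| {-2}D (erefl #|D|) => [|d IH] D dE.
  by move/eqP: dE; rewrite cards_eq0 => /eqP ->.
have /set0Pn[x xD] : D != set0 by rewrite -cards_eq0 dE.
rewrite -(setD1K xD); apply: PU; first by rewrite !inE eqxx.
by apply: IH; move: dE; rewrite (cardsD1 x) xD => -[].
Qed.

Lemma gram11 {R : comPzRingType} {I : finType} (c : R) (y : I -> R) (D : {set I}) :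
  gram c y 1 1 D = 1.
Proof.
move: D; apply: finset_induction => [|x D xD IH]; first exact: gram_set0.
by rewrite gramU1 // IH (gramC c y 1 0) /= !gram_mem0; ring.
Qed.

Lemma gram12 {R : comPzRingType} {I : finType} (c : R) (y : I -> R) (D : {set I}) :
  gram c y 1 2 D = 1 - \sum_(i in D) y i.
Proof.
move: D; apply: finset_induction => [|x D xD IH]; first by rewrite gram_set0 big_set0 subr0.
by rewrite gramU1 // IH big_setU1 //= !gram_mem0 gram11; ring.
Qed.

Lemma gram22 {R : comPzRingType} {I : finType} (c : R) (y : I -> R) (D : {set I}) :
  gram c y 2 2 D = (1 - \sum_(i in D) y i) ^+ 2 + c * \sum_(i in D) y i ^+ 2.
Proof.
move: D; apply: finset_induction => [|x D xD IH].
  by rewrite gram_set0 !big_set0; ring.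
by rewrite gramU1 // IH !big_setU1 //= (gramC c y 2 1) gram12 gram11; ring.
Qed.

(** If the sum of squares vanishes, so do all coordinates in [D], and the other square is 1. *)
Lemma gram22_gt0 {R : realDomainType} {I : finType} (c : R) (y : I -> R) (D : {set I}) :
  0 < c -> 0 < gram c y 2 2 D.
Proof.
move=> c0; rewrite gram22.
have q0 : 0 <= \sum_(i in D) y i ^+ 2 by apply: sumr_ge0 => i _; exact: sqr_ge0.
have [q|q] := eqVneq (\sum_(i in D) y i ^+ 2) 0; last first.
  by rewrite ltr_wpDl ?sqr_ge0 // mulr_gt0 // lt0r q.
rewrite q mulr0 addr0 big1 ?subr0 ?expr1n ?ltr01 // => i iD.
have /(_ i iD)/eqP := psumr_eq0P (fun i _ => sqr_ge0 (y i)) q.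
by rewrite sqrf_eq0 => /eqP.
Qed.

(* For [m <= 4], the terms of degree less than [m] in [(1 - t)^N]. *)
Definition ell {R : realFieldType} (t : R) (m : nat) (N : R) : R :=
  match m with
  | 0 => 0 | 1 => 1 | 2 => 1 - N * t
  | 3 => 1 - N * t + N * (N - 1) / 2 * t ^+ 2
  | _ => 1 - N * t + N * (N - 1) / 2 * t ^+ 2 - N * (N - 1) * (N - 2) / 6 * t ^+ 3
  end.

(** The sum defining [gram] grouped by [j = #|S|] for [N] coordinates equal to [t]: binomial(N, j)
    sets, each with Lagrange polynomial [t^j ell t (m - j) (N - j)]. A real [N] makes the recursion
    a polynomial identity. *)
Definition equal_gram {R : realFieldType} (c t : R) (m n : nat) (N : R) : R :=
  ell t m N * ell t n N
  + c * t ^+ 2 * N * (ell t (m - 1) (N - 1) * ell t (n - 1) (N - 1))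
  + c ^+ 2 * t ^+ 4 * (N * (N - 1) / 2) * (ell t (m - 2) (N - 2) * ell t (n - 2) (N - 2))
  + c ^+ 3 * t ^+ 6 * (N * (N - 1) * (N - 2) / 6) *
    (ell t (m - 3) (N - 3) * ell t (n - 3) (N - 3)).

Lemma equal_gramS {R : realFieldType} (c t N : R) (m n : nat) :
  (m <= 4)%N -> (n <= 4)%N ->
  equal_gram c t m n (1 + N) = equal_gram c t m n N
    - t * (equal_gram c t m.-1 n N + equal_gram c t m n.-1 N)
    + (1 + c) * t ^+ 2 * equal_gram c t m.-1 n.-1 N.
Proof.
by case: m => [|[|[|[|[|//]]]]] _; case: n => [|[|[|[|[|//]]]]] _;
  rewrite /equal_gram /=; field.
Qed.

Lemma gram_equal {R : realFieldType} {I : finType} (c t : R) (y : I -> R)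
    (m n : nat) (D : {set I}) :
  (m <= 4)%N -> (n <= 4)%N -> {in D, forall i, y i != 0 -> y i = t} ->
  gram c y m n D = equal_gram c t m n #|[set i in D | y i != 0]|%:R.
Proof.
move: D m n; apply: finset_induction => [|x D xD IH] m n m4 n4 yt.
  rewrite (_ : [set i in set0 | _] = set0) ?cards0; last first.
    by apply/setP => i; rewrite !inE.
  case: m m4 => [|m] m4; first by rewrite gram_mem0 /equal_gram /=; ring.
  case: n n4 => [|n] n4; first by rewrite gramC gram_mem0 /equal_gram /=; ring.
  rewrite gram_set0; move: m m4 n n4.
  by case=> [|[|[|[|//]]]] _; case=> [|[|[|[|//]]]] _; rewrite /equal_gram /=; field.
have yD : {in D, forall i, y i != 0 -> y i = t} by move=> i iD; apply: yt; rewrite inE iD orbT.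
have p k : (k <= 4)%N -> (k.-1 <= 4)%N by exact: leq_trans (leq_pred _).
rewrite gramU1 // !IH ?p //.
have [y0|y0] := eqVneq (y x) 0.
  rewrite (_ : [set i in x |: D | _] = [set i in D | y i != 0]); first by rewrite y0; ring.
  by apply/setP => i; rewrite !inE; case: eqP => // ->; rewrite y0 eqxx /= andbF.
rewrite (_ : [set i in x |: D | _] = x |: [set i in D | y i != 0]).
  rewrite cardsU1 inE (negbTE xD) /= natrD equal_gramS //.
  by rewrite (yt x) ?setU11.
by apply/setP => i; rewrite !inE; case: eqP => // ->; rewrite y0.
Qed.

(** Squarefree monomials in at most three variables have degree at most 3, so nothing is truncated
    and the Gram function is a product over the coordinates. *)
Lemma equal_gram_small {R : realFieldType} (c t : R) (N : nat) : (N <= 3)%N ->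
  equal_gram c t 4 4 N%:R = ((1 - t) ^+ 2 + c * t ^+ 2) ^+ N.
Proof.
by case: N => [|[|[|[|//]]]] _; rewrite /equal_gram /=; field.
Qed.

(** * The case of equal coordinates *)

Lemma expR_ge_partial_sum {R : realType} (x : R) (n : nat) :
  0 <= x -> \sum_(0 <= i < n) x ^+ i / i`!%:R <= expR x.
Proof.
move=> x0; apply: (@nondecreasing_cvgn_le _ (series (exp_coeff x))).
  apply/nondecreasing_seqP => m; rewrite -subr_ge0 /series/= big_nat_recr//=.
  by rewrite addrAC subrr add0r exp_coeff_ge0.
exact: is_cvg_series_exp_coeff.
Qed.

Lemma expR2_ge {R : realType} : 7387 / 1000 <= expR 2 :> R.
Proof.
apply: le_trans (expR_ge_partial_sum 2 10 _); last by [].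
rewrite !big_nat_recr //= big_geq // /factorial /=; lra.
Qed.

Lemma expR2_le {R : realType} : expR 2 <= 188 / 25 :> R.
Proof.
have halve (y c d : R) : expR (y / 2) <= c -> c ^+ 2 <= d -> expR y <= d.
  move=> yc; apply: le_trans.
  have -> : y = 2%:R * (y / 2) by lra.
  by rewrite expRM_natl lerXn2r ?nnegrE ?expR_ge0 // (le_trans (expR_ge0 _) yc).
(* [e^(1/64) <= 64/63] follows from [e^(-x) >= 1 - x]; seven squarings, rounded up where convenient,
   lead to [e^2]. *)
have x0 : expR (2 / 2 / 2 / 2 / 2 / 2 / 2 / 2) <= 64 / 63 :> R.
  have := expR_ge1Dx (- (2 / 2 / 2 / 2 / 2 / 2 / 2 / 2) : R).
  rewrite expRN.
  have := expR_gt0 (2 / 2 / 2 / 2 / 2 / 2 / 2 / 2 : R).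
  set u := expR _ => u0 h.
  have : (1 - 1 / 64) * u <= u^-1 * u by rewrite ler_pM2r //; lra.
  by rewrite mulVf ?gt_eqF //; lra.
apply: (halve _ (1371 / 500)); last lra.
apply: (halve _ (4139 / 2500)); last lra.
apply: (halve _ (193 / 150)); last lra.
apply: (halve _ (321 / 283)); last lra.
apply: (halve _ (475 / 446)); last lra.
apply: (halve _ (4096 / 3969)); last lra.
by apply: (halve _ (64 / 63)); last lra.
Qed.

(* The value of the Gram function at [N] equal coordinates [t], in terms of
   [r = 1/N] and [s = N t]; see [equal_gramE]. *)
Definition equal_poly {R : realType} (a r s : R) : R :=
  let c2 := 1 - r in let c3 := (1 - r) * (1 - 2 * r) in
  (1 - s + c2 * s ^+ 2 / 2 - c3 * s ^+ 3 / 6) ^+ 2 +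
  a * r * s ^+ 2 * (1 - c2 * s + c3 * s ^+ 2 / 2) ^+ 2 +
  a ^+ 2 * r ^+ 2 * c2 / 2 * s ^+ 4 * (1 - (1 - 2 * r) * s) ^+ 2 +
  a ^+ 3 * r ^+ 3 * c3 / 6 * s ^+ 6.

(** * Equal coordinates with sum at most 9/5 *)

Lemma sqr_le1 {R : realType} (x : R) : -1 <= x -> x <= 1 -> x ^+ 2 <= 1.
Proof.
move=> h1 h2; have : 0 <= (1 - x) * (1 + x) by rewrite mulr_ge0 //; lra.
lra.
Qed.

Lemma c3_ge0 {R : realType} (r : R) : 0 <= r -> r <= 1 / 4 ->
  0 <= (1 - r) * (1 - 2 * r).
Proof. by move=> r0 r1; rewrite mulr_ge0 //; lra. Qed.

Lemma c3_le {R : realType} (r : R) : 0 <= r -> r <= 1 / 4 ->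
  (1 - r) * (1 - 2 * r) <= 1 - r.
Proof. by move=> r0 r1; rewrite ler_piMr //; lra. Qed.

Lemma ell3_small {R : realType} (r s : R) :
  0 <= r -> r <= 1 / 4 -> 0 <= s -> s <= 9 / 5 ->
  (1 - s + (1 - r) * s ^+ 2 / 2 - (1 - r) * (1 - 2 * r) * s ^+ 3 / 6) ^+ 2 <= 1.
Proof.
move=> r0 r1 s0 s1; have c30 := c3_ge0 r r0 r1; have c31 := c3_le r r0 r1.
set c3 := _ * (1 - 2 * r) in c30 c31 *; clearbody c3.
have h0 : 0 <= c3 * s ^+ 3 by rewrite mulr_ge0 ?exprn_ge0.
have h1 : c3 * s ^+ 3 <= (1 - r) * s ^+ 2 * (9 / 5).
  rewrite exprSr mulrA ler_pM ?mulr_ge0 ?sqr_ge0 //.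
  by rewrite ler_wpM2r ?sqr_ge0.
have h2 : (1 - r) * s ^+ 2 <= s * (9 / 5).
  rewrite expr2 mulrA ler_pM ?mulr_ge0 //; first lra.
  by rewrite ler_piMl //; lra.
have h3 : 0 <= (1 - r) * s ^+ 2 by rewrite mulr_ge0 ?sqr_ge0 //; lra.
apply: sqr_le1; lra.
Qed.

Lemma ell2_small {R : realType} (r s : R) :
  0 <= r -> r <= 1 / 4 -> 0 <= s -> s <= 9 / 5 ->
  (1 - (1 - r) * s + (1 - r) * (1 - 2 * r) * s ^+ 2 / 2) ^+ 2 <= 1.
Proof.
move=> r0 r1 s0 s1; have c30 := c3_ge0 r r0 r1; have c31 := c3_le r r0 r1.
set c3 := _ * (1 - 2 * r) in c30 c31 *; clearbody c3.
have h1 : c3 * s ^+ 2 <= (1 - r) * s * (9 / 5).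
  by rewrite expr2 mulrA ler_pM ?mulr_ge0 // ler_wpM2r.
have h2 : (1 - r) * s <= s by rewrite ler_piMl //; lra.
have h3 : 0 <= (1 - r) * s by rewrite mulr_ge0 //; lra.
have h4 : 0 <= c3 * s ^+ 2 by rewrite mulr_ge0 ?sqr_ge0.
apply: sqr_le1; lra.
Qed.

Lemma ell1_small {R : realType} (r s : R) :
  0 <= r -> r <= 1 / 4 -> 0 <= s -> s <= 9 / 5 ->
  (1 - (1 - 2 * r) * s) ^+ 2 <= 1.
Proof.
move=> r0 r1 s0 s1.
have h2 : (1 - 2 * r) * s <= s by rewrite ler_piMl //; lra.
have h3 : 0 <= (1 - 2 * r) * s by rewrite mulr_ge0 //; lra.
apply: sqr_le1; lra.
Qed.

(** The left-hand side is what remains of [equal_poly] when its three squared polynomials are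
    replaced by 1 and its coefficients are bounded using [e^2 <= 188/25] and [r <= 1/4]. *)
Lemma expR_ge_small {R : realType} (s : R) : 0 <= s -> s <= 9 / 5 ->
  1 + 47 / 25 * s ^+ 2 + 171 / 128 * s ^+ 4 + 5 / 12 * s ^+ 6 <= expR (2 * s).
Proof.
move=> s0 s1.
have ex : 1 + 2 * s + 2 * s ^+ 2 + 4 / 3 * s ^+ 3 + 2 / 3 * s ^+ 4 +
    4 / 15 * s ^+ 5 + 4 / 45 * s ^+ 6 + 8 / 315 * s ^+ 7 + 2 / 315 * s ^+ 8
    <= expR (2 * s).
  have := expR_ge_partial_sum (2 * s) 9; rewrite unlock /reducebig /factorial /=.
  lra.
apply: le_trans ex.
have s3 : s ^+ 3 <= 146 / 25.
  apply: le_trans (_ : (9 / 5) ^+ 3 <= _); last lra.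
  by rewrite lerXn2r ?nnegrE //; lra.
have s4 : s ^+ 4 <= 146 / 25 * s by rewrite exprSr ler_wpM2r.
(* Up to sign and rounding, this is the part of degrees 5 to 8 of the difference of both sides,
   divided by [s^5]; the bound is close to its value at [s = 9/5]. *)
have b : 33 / 100 * s - 4 / 15 - 8 / 315 * s ^+ 2 - 2 / 315 * s ^+ 3 <= 21 / 100.
  have := mulr_ge0 s0 (sqr_ge0 (s - 9 / 5)).
  have := sqr_ge0 (s - 9 / 5).
  lra.
have s40 : 0 <= s ^+ 4 by exact: exprn_ge0.
have h1 : s ^+ 4 *
    (33 / 100 * s - 4 / 15 - 8 / 315 * s ^+ 2 - 2 / 315 * s ^+ 3) <=
    146 / 25 * s * (21 / 100).
  apply: le_trans (_ : s ^+ 4 * (21 / 100) <= _); first exact: ler_wpM2l.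
  by apply: ler_wpM2r => //; lra.
have h2 : 0 <= (4 / 3 - 67 / 100 * s) * s ^+ 2.
  by rewrite mulr_ge0 ?sqr_ge0 //; lra.
have h : 0 <= 2 + 3 / 25 * s + (4 / 3 - 67 / 100 * s) * s ^+ 2 -
     s ^+ 4 * (33 / 100 * s - 4 / 15 - 8 / 315 * s ^+ 2 - 2 / 315 * s ^+ 3).
  lra.
have := mulr_ge0 s0 h.
have := sqr_ge0 s; have := exprn_ge0 6 s0.
lra.
Qed.

Lemma equal_poly_small {R : realType} (r s : R) :
  0 <= r -> r <= 1 / 4 -> 0 <= s -> s <= 9 / 5 ->
  equal_poly (expR 2) r s <= expR (2 * s).
Proof.
move=> r0 r1 s0 s1; apply: le_trans (expR_ge_small s s0 s1).
have a1 := @expR2_le R; have a0 := @expR_ge0 R 2; rewrite /equal_poly.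
set a := expR 2 in a1 a0 *.
have b0 := ell3_small r s r0 r1 s0 s1.
have b1 := ell2_small r s r0 r1 s0 s1.
have b2 := ell1_small r s r0 r1 s0 s1.
have c30 := c3_ge0 r r0 r1.
have t1 : a * r * s ^+ 2 * (1 - (1 - r) * s + (1 - r) * (1 - 2 * r) * s ^+ 2 / 2) ^+ 2 <=
    47 / 25 * s ^+ 2.
  have h : a * r <= 47 / 25.
    by apply: le_trans (_ : 188 / 25 * (1 / 4) <= _); [exact: ler_pM|lra].
  apply: le_trans (_ : a * r * s ^+ 2 <= _); last by rewrite ler_wpM2r ?sqr_ge0.
  by rewrite ler_piMr // !mulr_ge0 ?sqr_ge0 //; lra.
(* The bound is the value at [r = 1/4]; the second product is exactly the difference. *)
have h2 : r ^+ 2 * (1 - r) <= 3 / 64.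
  have h0 : 0 <= (3 / 4 - r) * r by rewrite mulr_ge0 //; lra.
  have : 0 <= (1 / 4 - r) * (3 / 16 + (3 / 4 - r) * r) by rewrite mulr_ge0 //; lra.
  lra.
have a2 : a ^+ 2 <= 57.
  apply: le_trans (_ : (188 / 25) ^+ 2 <= _); last lra.
  by rewrite lerXn2r ?nnegrE //; lra.
have a3 : a ^+ 3 <= 426.
  apply: le_trans (_ : (188 / 25) ^+ 3 <= _); last lra.
  by rewrite lerXn2r ?nnegrE //; lra.
have t2 : a ^+ 2 * r ^+ 2 * (1 - r) / 2 * s ^+ 4 * (1 - (1 - 2 * r) * s) ^+ 2 <=
    171 / 128 * s ^+ 4.
  have h0 : 0 <= r ^+ 2 * (1 - r) by rewrite mulr_ge0 ?sqr_ge0 //; lra.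
  have s40 : 0 <= s ^+ 4 by exact: exprn_ge0.
  have h : a ^+ 2 * (r ^+ 2 * (1 - r)) <= 57 * (3 / 64).
    by apply: ler_pM => //; exact: sqr_ge0.
  rewrite -[_ * _ * (1 - r)]mulrA.
  apply: le_trans (_ : a ^+ 2 * (r ^+ 2 * (1 - r)) / 2 * s ^+ 4 <= _).
    by rewrite ler_piMr // !mulr_ge0 ?sqr_ge0 ?invr_ge0 //; lra.
  by rewrite ler_wpM2r //; lra.
have t3 : a ^+ 3 * r ^+ 3 * ((1 - r) * (1 - 2 * r)) / 6 * s ^+ 6 <= 5 / 12 * s ^+ 6.
  apply: ler_wpM2r; first exact: exprn_ge0.
  have h1 : 0 <= r ^+ 3 * ((1 - r) * (1 - 2 * r)) by rewrite mulr_ge0 // exprn_ge0.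
  have h3 : r ^+ 3 * ((1 - r) * (1 - 2 * r)) <= 3 / 64 * (1 / 8).
    rewrite (_ : _ * _ = r ^+ 2 * (1 - r) * (r * (1 - 2 * r))); last by ring.
    apply: ler_pM => //; rewrite ?mulr_ge0 ?sqr_ge0 //; try lra.
    have := sqr_ge0 (1 / 4 - r); lra.
  rewrite -[_ * _ * (_ * _)]mulrA.
  have h : a ^+ 3 * (r ^+ 3 * ((1 - r) * (1 - 2 * r))) <= 426 * (3 / 64 * (1 / 8)).
    by apply: ler_pM => //; exact: exprn_ge0.
  lra.
lra.
Qed.

(** * Equal coordinates with sum at least 9/5 *)

(** The tangent bound [e^x >= e x] at [x = s / n], raised to the power [2 n]; it is sharp at
    [s = n]. *)
Lemma expR_ge_pow {R : realType} (s : R) (n : nat) : 0 <= s -> (0 < n)%N ->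
  expR 2 ^+ n * (s / n%:R) ^+ (2 * n) <= expR (2 * s).
Proof.
move=> s0 n0; have n1 : n%:R != 0 :> R by rewrite pnatr_eq0 -lt0n.
have -> : expR (2 * s) = expR (s / n%:R) ^+ (2 * n).
  by rewrite -expRM_natl natrM; congr expR; field.
have -> : expR 2 = expR 1 ^+ 2 :> R by rewrite -expRM_natl mulr1.
rewrite -exprM -exprMn lerXn2r ?nnegrE ?mulr_ge0 ?expR_ge0 ?invr_ge0 //.
rewrite -{2}[s / n%:R](subrK 1) expRD mulrC ler_wpM2r ?expR_ge0 //.
by have := expR_ge1Dx (s / n%:R - 1); rewrite addrC subrK.
Qed.

(** In [z = s^-1] the unbounded range of [s] becomes a bounded interval, the factor [s ^+ 6] cancels
    against [expR_ge_pow], and the bracket is sorted by powers of [a]. *)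
Lemma equal_poly_scaled {R : realType} (a r s : R) : s != 0 ->
  equal_poly a r s = s ^+ 6 *
   ((s^-1 ^+ 3 - s^-1 ^+ 2 + (1 - r) * s^-1 / 2 - (1 - r) * (1 - 2 * r) / 6) ^+ 2
  + a * (r * (s^-1 ^+ 2 - (1 - r) * s^-1 + (1 - r) * (1 - 2 * r) / 2) ^+ 2)
  + a ^+ 2 * (r ^+ 2 * (1 - r) / 2 * (s^-1 - (1 - 2 * r)) ^+ 2)
  + a ^+ 3 * (r ^+ 3 * ((1 - r) * (1 - 2 * r)) / 6)).
Proof. by move=> s0; rewrite /equal_poly; field. Qed.

(** After division by [a ^+ 3] the negative powers of [a] have nonnegative coefficients, so the
    worst case is the lower bound [b]. *)
Lemma cubic_homog_le {R : realType} (b a X0 X1 X2 X3 k : R) :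
  0 < b -> b <= a -> 0 <= X0 -> 0 <= X1 -> 0 <= X2 ->
  X0 / b ^+ 3 + X1 / b ^+ 2 + X2 / b + X3 <= k ->
  X0 + a * X1 + a ^+ 2 * X2 + a ^+ 3 * X3 <= a ^+ 3 * k.
Proof.
move=> b0 ba x0 x1 x2 h.
have a0 : 0 < a by exact: lt_le_trans ba.
have up n X : 0 <= X -> X <= a ^+ n * (X / b ^+ n).
  move=> X_ge0; rewrite mulrCA ler_peMr // ler_pdivlMr ?exprn_gt0 // mul1r.
  by rewrite lerXn2r ?nnegrE ?(ltW b0) ?(ltW a0).
apply: le_trans (_ : a ^+ 3 * (X0 / b ^+ 3 + X1 / b ^+ 2 + X2 / b + X3) <= _).
  rewrite !mulrDr; apply: lerD => //; apply: lerD; [apply: lerD|].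
  - exact: up.
  - by rewrite (exprS a 2) -mulrA ler_wpM2l ?up // ltW.
  by rewrite (exprSr a 2) -mulrA ler_wpM2l ?sqr_ge0 //; exact: (up 1%N).
by rewrite ler_wpM2l // exprn_ge0 // ltW.
Qed.

Lemma sqr_le {R : realType} (x c : R) : - c <= x -> x <= c -> x ^+ 2 <= c ^+ 2.
Proof.
move=> h1 h2; have : 0 <= (c - x) * (c + x) by rewrite mulr_ge0 //; lra.
lra.
Qed.

(** The coefficients are bounded separately for [r = 1/4] and for [r <= 1/5]. That of [a ^+ 3] is
    largest at [r = 1/4], and pairing it with the other bounds for [r <= 1/5] would exceed what is
    available. *)
Lemma quarter_ell3 {R : realType} (r z : R) :
  r = 1 / 4 -> 0 <= z -> z <= 5 / 9 ->
  (z ^+ 3 - z ^+ 2 + (1 - r) * z / 2 - (1 - r) * (1 - 2 * r) / 6) ^+ 2 <= 1 / 250.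
Proof.
(* At [r = 1/4] the cubic is [z (z - 1/2)^2 + z/8 - 1/16], with minimum [-1/16] at [z = 0]. *)
move=> -> z0 z1; have := sqr_ge0 (z - 3 / 8); have := mulr_ge0 z0 (sqr_ge0 (z - 1 / 2)).
have : 0 <= z * (5 / 9 - z) by rewrite mulr_ge0 //; lra.
have : 0 <= z ^+ 2 * (5 / 9 - z) by rewrite mulr_ge0 ?sqr_ge0 //; lra.
move=> h0 h1 h2 h3.
apply: le_trans (_ : (63 / 1000) ^+ 2 <= _); last lra.
apply: sqr_le; lra.
Qed.

Lemma quarter_ell2 {R : realType} (r z : R) :
  r = 1 / 4 -> 0 <= z -> z <= 5 / 9 ->
  r * (z ^+ 2 - (1 - r) * z + (1 - r) * (1 - 2 * r) / 2) ^+ 2 <= 9 / 1000.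
Proof.
move=> -> z0 z1; have := sqr_ge0 (z - 3 / 8).
have : 0 <= z * (5 / 9 - z) by rewrite mulr_ge0 //; lra.
move=> h0 h1; rewrite mulrC -ler_pdivlMr; last lra.
apply: le_trans (_ : (3 / 16) ^+ 2 <= _); last lra.
apply: sqr_le; lra.
Qed.

Lemma quarter_ell2_mid {R : realType} (r z : R) :
  r = 1 / 4 -> 23 / 100 <= z -> z <= 5 / 9 ->
  r * (z ^+ 2 - (1 - r) * z + (1 - r) * (1 - 2 * r) / 2) ^+ 2 <= 1 / 400.
Proof.
move=> -> z0 z1; have : 0 <= (z - 23 / 100) * (5 / 9 - z) by rewrite mulr_ge0 //; lra.
have := sqr_ge0 (z - 3 / 8) => h1 h2; rewrite mulrC -ler_pdivlMr; last lra.
apply: le_trans (_ : (1 / 10) ^+ 2 <= _); last lra.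
apply: sqr_le; lra.
Qed.

Lemma quarter_ell1 {R : realType} (r z : R) :
  r = 1 / 4 -> 0 <= z -> z <= 5 / 9 ->
  r ^+ 2 * (1 - r) / 2 * (z - (1 - 2 * r)) ^+ 2 <= 3 / 512.
Proof.
by move=> -> z0 z1; have : 0 <= z * (1 - z) by [rewrite mulr_ge0 //; lra]; lra.
Qed.

Lemma quarter_ell1_mid {R : realType} (r z : R) :
  r = 1 / 4 -> 23 / 100 <= z -> z <= 5 / 9 ->
  r ^+ 2 * (1 - r) / 2 * (z - (1 - 2 * r)) ^+ 2 <= 171 / 1000 / 100.
Proof.
move=> -> z0 z1.
by have : 0 <= (z - 23 / 100) * (77 / 100 - z) by [rewrite mulr_ge0 //; lra]; lra.
Qed.

Lemma quarter_c3_cube {R : realType} (r : R) : r = 1 / 4 ->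
  r ^+ 3 * ((1 - r) * (1 - 2 * r)) <= 3 / 512.
Proof. by move=> ->; lra. Qed.

Lemma tail_ell3 {R : realType} (r z : R) :
  0 <= r -> r <= 1 / 5 -> 0 <= z -> z <= 5 / 9 ->
  (z ^+ 3 - z ^+ 2 + (1 - r) * z / 2 - (1 - r) * (1 - 2 * r) / 6) ^+ 2 <= 3 / 100.
Proof.
move=> r0 r1 z0 z1.
apply: le_trans (_ : (17 / 100) ^+ 2 <= _); last lra.
have h1 : 0 <= r * z by exact: mulr_ge0.
have h2 : 0 <= r * (1 / 5 - r) by rewrite mulr_ge0 //; lra.
have h3 := mulr_ge0 z0 (sqr_ge0 (z - 1 / 2)).
have h4 : 0 <= r * (5 / 9 - z) by rewrite mulr_ge0 //; lra.
have h5 : 0 <= z ^+ 2 * (5 / 9 - z) by rewrite mulr_ge0 ?sqr_ge0 //; lra.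
have h6 := sqr_ge0 (z - 1 / 2); have h7 := sqr_ge0 r.
apply: sqr_le; lra.
Qed.

Lemma tail_ell2 {R : realType} (r z : R) :
  0 <= r -> r <= 1 / 5 -> 0 <= z -> z <= 5 / 9 ->
  r * (z ^+ 2 - (1 - r) * z + (1 - r) * (1 - 2 * r) / 2) ^+ 2 <= 11 / 625.
Proof.
move=> r0 r1 z0 z1.
set b := z ^+ 2 - _ + _.
have h2 : 0 <= r * (1 / 5 - r) by rewrite mulr_ge0 //; lra.
have h1 : 0 <= z * (1 - z) by rewrite mulr_ge0 //; lra.
have h3 : b <= 1 / 2 - 53 / 50 * r.
  have : 0 <= z * (1 - r - z) by rewrite mulr_ge0 //; lra.
  rewrite /b; lra.
have h4 : 0 <= b.
  have := sqr_ge0 (z - (1 - r) / 2).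
  have : 0 <= (1 - r) * (1 - 3 * r) by rewrite mulr_ge0 //; lra.
  rewrite /b; lra.
apply: le_trans (_ : r * (1 / 2 - 53 / 50 * r) ^+ 2 <= _).
  by rewrite ler_wpM2l // lerXn2r ?nnegrE //; lra.
(* [157/1000] approximates the maximizer of the cubic in [r]; the certificate has a double zero
   there. *)
have : 0 <= (1 / 5 - r) * (r - 157 / 1000) ^+ 2.
  by rewrite mulr_ge0 ?sqr_ge0 //; lra.
have := sqr_ge0 (r - 157 / 1000).
lra.
Qed.

Lemma tail_ell2_mid {R : realType} (r z : R) :
  0 <= r -> r <= 1 / 5 -> 23 / 100 <= z -> z <= 5 / 9 ->
  r * (z ^+ 2 - (1 - r) * z + (1 - r) * (1 - 2 * r) / 2) ^+ 2 <= 7 / 1000.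
Proof.
move=> r0 r1 z0 z1.
set b := z ^+ 2 - _ + _.
have h2 : 0 <= r * (1 / 5 - r) by rewrite mulr_ge0 //; lra.
have h0 : 0 <= r * (5 / 9 - z) by rewrite mulr_ge0 //; lra.
have h1 : 0 <= (z - 23 / 100) * (77 / 100 - z) by rewrite mulr_ge0 //; lra.
have h3 : b <= 323 / 1000 - 93 / 125 * r by rewrite /b; lra.
have h4 : 0 <= b.
  have := sqr_ge0 (z - (1 - r) / 2).
  have : 0 <= (1 - r) * (1 - 3 * r) by rewrite mulr_ge0 //; lra.
  rewrite /b; lra.
apply: le_trans (_ : r * (323 / 1000 - 93 / 125 * r) ^+ 2 <= _).
  by rewrite ler_wpM2l // lerXn2r ?nnegrE //; lra.
have : 0 <= (1 / 5 - r) * (r - 29 / 200) ^+ 2.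
  by rewrite mulr_ge0 ?sqr_ge0 //; lra.
have := sqr_ge0 (r - 29 / 200).
lra.
Qed.

Lemma tail_ell1 {R : realType} (r z : R) :
  0 <= r -> r <= 1 / 5 -> 0 <= z -> z <= 5 / 9 ->
  r ^+ 2 * (1 - r) / 2 * (z - (1 - 2 * r)) ^+ 2 <= 29 / 5000.
Proof.
move=> r0 r1 z0 z1.
have h : (z - (1 - 2 * r)) ^+ 2 <= (1 - 2 * r) ^+ 2.
  have := mulr_ge0 z0 (_ : 0 <= 2 * (1 - 2 * r) - z); lra.
have p0 : 0 <= r * (1 - 2 * r) by rewrite mulr_ge0 //; lra.
have p1 : r * (1 - 2 * r) <= 3 / 25.
  have : 0 <= (1 / 5 - r) * (3 / 10 - r) by rewrite mulr_ge0 //; lra.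
  lra.
have p2 : r * (1 - 2 * r) * (1 - r) <= 12 / 125.
  have h1 : 0 <= (1 / 5 - r) * (11 / 5 - 2 * r) by rewrite mulr_ge0 //; lra.
  have : 0 <= (1 / 5 - r) * (1 / 25 + (1 / 5 - r) * (11 / 5 - 2 * r)).
    by rewrite mulr_ge0 //; lra.
  lra.
apply: le_trans (_ : r ^+ 2 * (1 - r) / 2 * (1 - 2 * r) ^+ 2 <= _).
  by rewrite ler_wpM2l // !mulr_ge0 ?sqr_ge0 //; lra.
rewrite (_ : _ * _ = r * (1 - 2 * r) * (r * (1 - 2 * r) * (1 - r)) / 2); last by ring.
have : r * (1 - 2 * r) * (r * (1 - 2 * r) * (1 - r)) <= 3 / 25 * (12 / 125).
  by rewrite ler_pM // mulr_ge0 //; lra.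
lra.
Qed.

Lemma tail_ell1_mid {R : realType} (r z : R) :
  0 <= r -> r <= 1 / 5 -> 23 / 100 <= z -> z <= 5 / 9 ->
  r ^+ 2 * (1 - r) / 2 * (z - (1 - 2 * r)) ^+ 2 <= 11 / 4000.
Proof.
move=> r0 r1 z0 z1.
have h : (r * (z - (1 - 2 * r))) ^+ 2 <= 11 / 2000.
  apply: le_trans (_ : (1853 / 2500 / 10) ^+ 2 <= _); last lra.
  have h1 : 0 <= r * (z - 23 / 100) by rewrite mulr_ge0 //; lra.
  have h2 : 0 <= r * (5 / 9 - z) by rewrite mulr_ge0 //; lra.
  (* [77/400] maximizes [r (77/100 - 2 r)], the absolute value of the base at [z = 23/100]. *)
  have h3 := sqr_ge0 (r - 77 / 400).
  have h4 : 0 <= r * (1 / 5 - r) by rewrite mulr_ge0 //; lra.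
  apply: sqr_le; lra.
rewrite (_ : _ * _ = (r * (z - (1 - 2 * r))) ^+ 2 * (1 - r) / 2); last by ring.
have : 0 <= (r * (z - (1 - 2 * r))) ^+ 2 * r by rewrite mulr_ge0 ?sqr_ge0.
lra.
Qed.

Lemma c3_cube {R : realType} (r : R) : 0 <= r -> r <= 1 / 5 ->
  r ^+ 3 * ((1 - r) * (1 - 2 * r)) <= 12 / 3125.
Proof.
move=> r0 r1.
have p0 : 0 <= r * ((1 - r) * (1 - 2 * r)) by rewrite !mulr_ge0 //; lra.
have p2 : r * ((1 - r) * (1 - 2 * r)) <= 12 / 125.
  have h1 : 0 <= (1 / 5 - r) * (11 / 5 - 2 * r) by rewrite mulr_ge0 //; lra.
  have : 0 <= (1 / 5 - r) * (1 / 25 + (1 / 5 - r) * (11 / 5 - 2 * r)).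
    by rewrite mulr_ge0 //; lra.
  lra.
rewrite (_ : _ * _ = r ^+ 2 * (r * ((1 - r) * (1 - 2 * r)))); last by ring.
apply: le_trans (_ : (1 / 5) ^+ 2 * (12 / 125) <= _); last lra.
by rewrite ler_pM ?sqr_ge0 // lerXn2r ?nnegrE //; lra.
Qed.

(** The disjunction fits [r = 1/N] with [N >= 4]. By [cubic_homog_le] the value [22/3] stands in for
    [e^2], leaving linear checks on four bounded coefficients. *)
Lemma equal_poly_large {R : realType} (r s : R) :
  r = 1 / 4 \/ 0 <= r /\ r <= 1 / 5 -> 9 / 5 <= s ->
  equal_poly (expR 2) r s <= expR (2 * s).
Proof.
move=> hr s1; have s0 : 0 < s by lra.
have a0 : 22 / 3 <= expR 2 :> R by have := @expR2_ge R; lra.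
rewrite equal_poly_scaled ?gt_eqF //; set a := expR 2 in a0 *.
have z0 : 0 <= s^-1 by rewrite invr_ge0 ltW.
have z1 : s^-1 <= 5 / 9.
  by rewrite (_ : 5 / 9 = (9 / 5)^-1) ?lef_pV2 ?posrE //; [lra | field].
have sz : s * s^-1 = 1 by rewrite divff ?gt_eqF.
set z := s^-1 in z0 z1 sz *.
have [c0 c1] : 0 <= r /\ r <= 1 / 4 by case: hr; lra.
have X1 : 0 <= r * (z ^+ 2 - (1 - r) * z + (1 - r) * (1 - 2 * r) / 2) ^+ 2.
  by rewrite mulr_ge0 ?sqr_ge0.
have X2 : 0 <= r ^+ 2 * (1 - r) / 2 * (z - (1 - 2 * r)) ^+ 2.
  rewrite mulr_ge0 ?sqr_ge0 // divr_ge0 // mulr_ge0 ?sqr_ge0 //; lra.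
(* [z = 23/100] is near the point where the tangent bounds [(e s / 3)^6] and
   [(e s / 4)^8] of [e^(2 s)] exchange their order. *)
case: (lerP (23 / 100) z) => z2.
  apply: le_trans (expR_ge_pow s 3 (ltW s0) isT).
  have -> : a ^+ 3 * (s / 3) ^+ (2 * 3) = s ^+ 6 * (a ^+ 3 * (1 / 729)) by field.
  rewrite ler_wpM2l ?exprn_ge0 ?(ltW s0) //.
  apply: (cubic_homog_le (22 / 3)) => //; [lra|exact: sqr_ge0|].
  case: hr => [rE|[r0 r1]].
    have := quarter_ell3 r z rE z0 z1.
    have := quarter_ell2_mid r z rE z2 z1.
    have := quarter_ell1_mid r z rE z2 z1.
    have := quarter_c3_cube r rE.
    clear; move: (_ ^+ 3 * _) => x3; move: (_ / 2 * _) => x2.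
    move: (r * _ ^+ 2) => x1; move: (_ ^+ 2) => x0; lra.
  have := tail_ell3 r z r0 r1 z0 z1.
  have := tail_ell2_mid r z r0 r1 z2 z1.
  have := tail_ell1_mid r z r0 r1 z2 z1.
  have := c3_cube r r0 r1.
  clear; move: (_ ^+ 3 * _) => x3; move: (_ / 2 * _) => x2.
    move: (r * _ ^+ 2) => x1; move: (_ ^+ 2) => x0; lra.
apply: le_trans (expR_ge_pow s 4 (ltW s0) isT).
have -> : a ^+ 4 * (s / 4) ^+ (2 * 4) = s ^+ 6 * (a ^+ 3 * (a * s ^+ 2 / 4 ^+ 8)) by field.
rewrite ler_wpM2l ?exprn_ge0 ?(ltW s0) //.
apply: (cubic_homog_le (22 / 3)) => //; [lra|exact: sqr_ge0|].
have s2 : 100 / 23 <= s.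
  have : s * z <= s * (23 / 100) by rewrite ler_wpM2l // ltW.
  lra.
have as2 : 22 / 3 * (100 / 23) ^+ 2 <= a * s ^+ 2.
  by rewrite ler_pM // ?sqr_ge0 ?lerXn2r ?nnegrE //; lra.
(* The left side is [(22/3) (100/23)^2 / 4^8] rounded down. *)
have k0 : 423 / 2000 / 100 <= a * s ^+ 2 / 4 ^+ 8 by rewrite ler_pdivlMr ?exprn_gt0 //; lra.
apply: le_trans k0.
case: hr => [rE|[r0 r1]].
  have := quarter_ell3 r z rE z0 z1.
  have := quarter_ell2 r z rE z0 z1.
  have := quarter_ell1 r z rE z0 z1.
  have := quarter_c3_cube r rE.
  clear; move: (_ ^+ 3 * _) => x3; move: (_ / 2 * _) => x2.
    move: (r * _ ^+ 2) => x1; move: (_ ^+ 2) => x0; lra.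
have := tail_ell3 r z r0 r1 z0 z1.
have := tail_ell2 r z r0 r1 z0 z1.
have := tail_ell1 r z r0 r1 z0 z1.
have := c3_cube r r0 r1.
clear; move: (_ ^+ 3 * _) => x3; move: (_ / 2 * _) => x2.
    move: (r * _ ^+ 2) => x1; move: (_ ^+ 2) => x0; lra.
Qed.

(** * Equal coordinates: the single factor and every [N] *)

(** Equality holds at [t = 0] and [t = 1]: a Taylor bound at 0 serves up to [1/2], and the fourth
    power of a tangent at 1 serves beyond. *)
Lemma factor_le_expR {R : realType} (t : R) : 0 <= t ->
  (1 - t) ^+ 2 + expR 2 * t ^+ 2 <= expR (2 * t).
Proof.
move=> t0; have [t1|t1] := lerP t (1 / 2).
  have := expR_ge_partial_sum (2 * t) 3; rewrite unlock /reducebig /factorial /=.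
  have at2 : expR 2 * t ^+ 2 <= 188 / 25 * (t * (1 / 2)).
    rewrite ler_pM ?expR_ge0 ?sqr_ge0 ?expR2_le // expr2.
    exact: ler_wpM2l.
  have := sqr_ge0 t; lra.
have -> : expR (2 * t) = expR 2 * expR ((t - 1) / 2) ^+ 4.
  by rewrite -expRM_natl -expRD; congr expR; field.
have h : ((t + 1) / 2) ^+ 4 <= expR ((t - 1) / 2) ^+ 4.
  have e1 := expR_ge1Dx ((t - 1) / 2).
  by rewrite lerXn2r ?nnegrE ?expR_ge0 //; lra.
apply: le_trans (_ : expR 2 * ((t + 1) / 2) ^+ 4 <= _); last first.
  by rewrite ler_wpM2l ?expR_ge0.
have a0 := @expR2_ge R.
have ta : 1 <= expR 2 * (t / 2).
  by apply: le_trans (_ : 4 * (1 / 4) <= _); [lra|rewrite ler_pM //; lra].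
(* Since [e^2 t / 2 >= 1], the middle term absorbs [(1 - t)^2]. *)
have -> : ((t + 1) / 2) ^+ 4 = t ^+ 2 + t / 2 * (t - 1) ^+ 2 + (t - 1) ^+ 4 / 16.
  by field.
have := ler_wpM2r (sqr_ge0 (1 - t)) ta.
have : 0 <= expR 2 * ((t - 1) ^+ 4 / 16).
  by rewrite mulr_ge0 ?expR_ge0 // divr_ge0 // exprn_even_ge0.
lra.
Qed.

Lemma equal_gramE {R : realType} (a t : R) (N : nat) : (0 < N)%N ->
  equal_gram a t 4 4 N%:R = equal_poly a N%:R^-1 (N%:R * t).
Proof.
move=> N0; rewrite /equal_gram /equal_poly /=; field.
by rewrite pnatr_eq0 -lt0n.
Qed.

Lemma equal_gram_le {R : realType} (t : R) (N : nat) : 0 <= t ->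
  equal_gram (expR 2) t 4 4 N%:R <= expR (2 * (N%:R * t)).
Proof.
move=> t0; have [N3|N4] := leqP N 3.
  rewrite equal_gram_small // (_ : 2 * _ = N%:R * (2 * t)); last by rewrite mulrCA.
    rewrite expRM_natl lerXn2r ?nnegrE ?expR_ge0 //.
    by apply: addr_ge0; [exact: sqr_ge0|exact: mulr_ge0 (expR_ge0 _) (sqr_ge0 _)].
  exact: factor_le_expR.
have N0 : 0 < N%:R :> R by rewrite ltr0n (leq_trans _ N4).
have rN (n : nat) : (0 < n)%N -> (n <= N)%N -> N%:R^-1 <= 1 / n%:R :> R.
  by move=> n0 nN; rewrite div1r lef_pV2 ?ler_nat // posrE // ltr0n.
have r0 : 0 <= N%:R^-1 :> R by rewrite invr_ge0 ltW.
rewrite equal_gramE ?(leq_trans _ N4) //.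
have [h|h] := lerP (N%:R * t) (9 / 5).
  by apply: equal_poly_small => //; [exact: rN|rewrite mulr_ge0 // ltW].
apply: equal_poly_large; last exact: ltW.
move: N4; rewrite leq_eqVlt => /predU1P[<-|N5]; [left|right]; first by rewrite div1r.
by split=> //; exact: rN.
Qed.

(** * Maximization over a simplex *)

Lemma simplex_max {R : realType} {k : nat} (s : R) (f : 'rV[R]_k -> R) :
  let simplex (v : 'rV[R]_k) := (forall i, 0 <= v 0 i) /\ \sum_i v 0 i = s in
  continuous f -> (exists v, simplex v) ->
  exists v, simplex v /\ forall w, simplex w -> f w <= f v.
Proof.
move=> simplex cf [v0 v0P].
(* The box bounds follow from nonnegativity and the sum; they exhibit the simplex as a closed part
   of a compact product of segments. *)
pose A := ([set v : 'rV[R]_k | forall i, `[0, s] (v 0 i)] `&`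
  (fun v : 'rV[R]_k => \sum_i v 0 i) @^-1` [set s])%classic.
have AE v : A v <-> simplex v.
  split=> [[v1 vs]|[v1 vs]]; split=> // i.
    by have := v1 i; rewrite /= in_itv /= => /andP[].
  rewrite /= in_itv /= v1 -vs (bigD1 i) //= lerDl.
  by apply: sumr_ge0.
have cA : compact A.
  apply: compact_closedI.
    have := @rV_compact R k (fun=> `[0, s]%classic).
    by apply => _; exact: segment_compact.
  apply: preimage_closed; last exact: closed_eq.
  move=> v _; apply: continuous_big => [|i _]; first exact: add_continuous.
  exact: coord_continuous.
have [|v vA vmax] := EVT_max_rV _ cA (continuous_subspaceT cf).
  by exists v0; apply/AE.
exists v; split; first by apply/AE; rewrite -in_setE.
by move=> w /AE wA; apply: vmax; rewrite in_setE.
Qed.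

Lemma continuous_gram {R : realType} {k : nat} (c : R) m n (D : {set 'I_k}) :
  continuous (fun v : 'rV[R]_k => gram c (v 0) m n D).
Proof.
have cM (g h : 'rV[R]_k -> R) : continuous g -> continuous h ->
    continuous (fun v => g v * h v).
  by move=> cg ch v; apply: continuousM; [exact: cg|exact: ch].
have cst (a : R) : continuous (fun _ : 'rV[R]_k => a).
  by move=> v; apply: (@cvg_cst _ _ _ (nbhs (v : 'rV[R]_k))).
have clag l S : continuous (fun v : 'rV[R]_k => lag (v 0) l D S).
  apply: continuous_big => [|U _]; first exact: add_continuous.
  apply: cM; first exact: cst.
  apply: continuous_big => [|i _]; first exact: mul_continuous.
  exact: coord_continuous.
apply: continuous_big => [|S _]; first exact: add_continuous.
by apply: (cM) => //; apply: cM => //; exact: cst.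
Qed.

(** A strictly convex quadratic whose value at [u > 0] is at least that at 0 is strictly increasing
    beyond [u]; so no interior point is a maximum. *)
Lemma convex_quadratic_interior {R : realType} (a b g u w : R) :
  0 < g -> 0 < u -> u < w -> a <= a + b * u + g * u ^+ 2 ->
  a + b * w + g * w ^+ 2 <= a + b * u + g * u ^+ 2 -> False.
Proof.
move=> g0 u0 uw h0 hw.
have h1 : 0 <= b + g * u by rewrite -(pmulr_rge0 _ u0); lra.
have h2 : 0 < b + g * (w + u).
  have : 0 < g * w by rewrite mulr_gt0 //; lra.
  lra.
have : 0 < (w - u) * (b + g * (w + u)) by rewrite mulr_gt0 // subr_gt0.
lra.
Qed.

Definition set2 {R : realType} {k : nat} (v : 'rV[R]_k) (i j : 'I_k) (a b : R) : 'rV[R]_k :=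
  \row_l if l == i then a else if l == j then b else v 0 l.

Lemma sum_set2 {R : realType} {k : nat} (v : 'rV[R]_k) (i j : 'I_k) (a b : R) :
  i != j -> a + b = v 0 i + v 0 j -> \sum_l set2 v i j a b 0 l = \sum_l v 0 l.
Proof.
move=> ij ab; rewrite (bigD1 i) // (bigD1 j) 1?eq_sym //=.
rewrite [RHS](bigD1 i) // [in RHS](bigD1 j) 1?eq_sym //= !mxE !eqxx.
rewrite eq_sym (negbTE ij) !addrA ab; congr (_ + _).
by apply: eq_bigr => l /andP[/negbTE li /negbTE lj]; rewrite mxE li lj.
Qed.

(* The two extreme values of [v_i v_j] for a given sum are attained by
   [(v_i + v_j, 0)] and by equal coordinates. *)
Lemma gram_max_equal {R : realType} {k : nat} (c : R) (v : 'rV[R]_k) (i j : 'I_k) :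
  0 < c -> (forall l, 0 <= v 0 l) ->
  (forall w : 'rV[R]_k, (forall l, 0 <= w 0 l) -> \sum_l w 0 l = \sum_l v 0 l ->
    gram c (w 0) 4 4 setT <= gram c (v 0) 4 4 setT) ->
  v 0 i != 0 -> v 0 j != 0 -> v 0 i = v 0 j.
Proof.
move=> c0 v0 vmax vi vj; apply/eqP/negPn/negP => vij.
have ij : i != j by apply: contraNneq vij => ->.
pose D : {set 'I_k} := ~: [set i; j].
have iD : i \notin D by rewrite !inE eqxx.
have jD : j \notin D by rewrite !inE eqxx orbT.
have TE : setT = i |: (j |: D).
  by apply/setP => l; rewrite !inE; case: (l == i) => //=; case: (l == j).
have gE m n a b : gram c (set2 v i j a b 0) m n D = gram c (v 0) m n D.
  apply: eq_gram => l; rewrite !inE mxE negb_or => /andP[/negbTE li /negbTE lj].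
  by rewrite li lj.
have vi0 : 0 < v 0 i by rewrite lt0r vi v0.
have vj0 : 0 < v 0 j by rewrite lt0r vj v0.
have max2 a b : 0 <= a -> 0 <= b -> a + b = v 0 i + v 0 j ->
    gram c (set2 v i j a b 0) 4 4 setT <= gram c (v 0) 4 4 setT.
  move=> a0 b0 ab; apply: vmax; last exact: sum_set2.
  by move=> l; rewrite mxE; case: ifP => // _; case: ifP.
have uw : v 0 i * v 0 j < ((v 0 i + v 0 j) / 2) ^+ 2.
  have : 0 < (v 0 i - v 0 j) ^+ 2 by rewrite exprn_even_gt0 //= subr_eq0.
  lra.
have u0 : 0 < v 0 i * v 0 j by rewrite mulr_gt0.
have g0 : 0 < (1 + c) ^+ 2 * gram c (v 0) 2 2 D.
  by rewrite mulr_gt0 ?gram22_gt0 // exprn_gt0 // addr_gt0.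
have := max2 (v 0 i + v 0 j) 0.
have := max2 ((v 0 i + v 0 j) / 2) ((v 0 i + v 0 j) / 2).
rewrite TE !gram_two // !gE !mxE !eqxx eq_sym (negbTE ij).
move=> hw h0; apply: (convex_quadratic_interior _ _ _ _ _ g0 u0 uw).
  apply: le_trans (h0 _ _ _); rewrite ?addr0 ?addr_ge0 //.
  rewrite mulr0 expr0n /= !mulr0 !addr0; exact: lexx.
apply: le_trans (hw _ _ _); rewrite -?splitr ?divr_ge0 ?addr_ge0 //.
Qed.

(** Passing to a maximizer with the same coordinate sum keeps the right-hand side, so only vectors
    with coinciding nonzero coordinates remain. *)
Lemma gram_le_expR {R : realType} {k : nat} (v : 'rV[R]_k) :
  (forall i, 0 <= v 0 i) ->
  gram (expR 2) (v 0) 4 4 setT <= expR (2 * \sum_i v 0 i).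
Proof.
move=> v0; have a0 : 0 < expR 2 :> R by exact: expR_gt0.
have /= [w [[w0 ws] wmax]] :=
  simplex_max (\sum_i v 0 i) _ (continuous_gram (expR 2) 4 4 setT) (ex_intro _ v (conj v0 erefl)).
apply: le_trans (wmax v (conj v0 erefl)) _; rewrite -ws.
have weq i j : w 0 i != 0 -> w 0 j != 0 -> w 0 i = w 0 j.
  by apply: (gram_max_equal _ w i j a0) => // u u0 us; apply: wmax; rewrite us.
have [t t0 tE] : exists2 t : R, 0 <= t & forall i, w 0 i != 0 -> w 0 i = t.
  have [i wi|w00] := pickP (fun i => w 0 i != 0).
    by exists (w 0 i) => // j wj; exact: weq.
  by exists 0 => // i; rewrite w00.
rewrite (gram_equal _ t) //; last by move=> i _; exact: tE.
set N := #|_|.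
rewrite (_ : \sum_i _ = N%:R * t); first exact: equal_gram_le.
rewrite mulr_natl -sumr_const.
rewrite (bigID (fun i => i \in [set i in setT | w 0 i != 0])) /= [X in _ + X]big1 ?addr0.
  by apply: eq_bigr => i; rewrite !inE => /tE.
by move=> i; rewrite !inE negbK => /eqP.
Qed.

(** * Determinants and the design *)

(** Interpolation: the monomial of [T] is 1 at the vertices [1_S] with [T \subset S] and 0 at the
    others. In the induction, the terms in [y x] cancel when [x] is not in [T]. *)
Lemma sum_lag {R : comPzRingType} {I : finType} (y : I -> R) (m : nat) (D T : {set I}) :
  T \subset D ->
  \sum_(S : {set I} | (S \subset D) && (T \subset S)) lag y m D S =
  if (#|T| < m)%N then \prod_(i in T) y i else 0.
Proof.
move: D T m; apply: finset_induction => [|x D xD IH] T m TD.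
  move: TD; rewrite subset0 => /eqP ->; rewrite (big_pred1 set0) => [|S]; last first.
    by rewrite sub0set andbT subset0.
  rewrite cards0 big_set0 /lag; case: m => [|m].
    by rewrite big_pred0 // => U; rewrite !andbF.
  rewrite (big_pred1 set0) => [|U]; first by rewrite cards0 big_set0 mulr1.
  by rewrite subset0 sub0set /=; case: eqP => // ->; rewrite cards0.
rewrite sum_subsetU1 //.
have [xT|xT] := boolP (x \in T).
  rewrite big1 ?add0r => [|S /andP[SD TS]]; last first.
    by case/negP: xD; apply: (subsetP SD); apply: (subsetP TS).
  have TD' : T :\ x \subset D by rewrite subDset.
  rewrite (cardsD1 x) xT (big_setD1 x) //=.
  rewrite (eq_big (fun S : {set I} => (S \subset D) && (T :\ x \subset S))
    (fun S => y x * lag y m.-1 D S)) => [|S|S /andP[SD _]].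
  - by rewrite -mulr_sumr IH // add1n -ltn_predRL; case: ifP => // _; rewrite mulr0.
  - by rewrite subDset.
  - by rewrite lagU1_in.
have Tx : T :\ x = T by apply/setP => i; rewrite !inE; case: eqP => // ->; rewrite (negbTE xT).
have TD' : T \subset D by rewrite -Tx subDset.
rewrite [X in _ + X](eq_big (fun S : {set I} => (S \subset D) && (T \subset S))
  (fun S => y x * lag y m.-1 D S)) => [|S|S /andP[SD _]].
- rewrite -IH // -big_split /=; apply: eq_bigr => S /andP[SD _].
  by rewrite lagU1_notin // subrK.
- by rewrite -subDset Tx.
- by rewrite lagU1_in.
Qed.

(** * Determinants of positive semidefinite matrices *)

Lemma psd_diag_ge0 {R : realFieldType} {n : nat} (N : 'M[R]_n) :
  (forall u : 'rV_n, 0 <= (u *m N *m u^T) 0 0) -> forall i, 0 <= N i i.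
Proof.
move=> psd i; have := psd (delta_mx 0 i).
by rewrite trmx_delta -rowE -colE !mxE.
Qed.

Lemma psd_zero_diag {R : realFieldType} {n : nat} (N : 'M[R]_n) (i j : 'I_n) :
  N^T = N -> (forall u : 'rV_n, 0 <= (u *m N *m u^T) 0 0) ->
  N i i = 0 -> N i j = 0.
Proof.
move=> sym psd ii; have Nji : N j i = N i j by rewrite -[in LHS]sym mxE.
apply/eqP/negPn/negP => ij0.
(* This [a] makes the quadratic form equal to -1. *)
pose a := - ((N j j + 1) / (2 * N i j)).
have := psd (a *: delta_mx 0 i + delta_mx 0 j).
rewrite linearP /= !trmx_delta mulmxDl mulmxDr !mulmxDl -!scalemxAl -!scalemxAr.
rewrite -!rowE -!colE !mxE ii Nji.
have -> : a * (a * 0) + a * N i j + (a * N i j + N j j) = - 1 by rewrite /a; field.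
by rewrite ler0N1.
Qed.

(** Induction by Schur complements: a zero pivot forces a zero row; otherwise the complement is
    again positive semidefinite and its diagonal entries do not exceed those of [N]. *)
Lemma hadamard {R : realFieldType} {n : nat} (N : 'M[R]_n) :
  N^T = N -> (forall u : 'rV_n, 0 <= (u *m N *m u^T) 0 0) ->
  \det N <= \prod_i N i i.
Proof.
elim: n N => [|n IH] N sym psd; first by rewrite det_mx00 big_ord0.
have d0 := psd_diag_ge0 N psd.
have [a0|a0] := eqVneq (N 0 0) 0.
  have -> : \det N = 0.
    rewrite (expand_det_row N 0) big1 // => j _.
    by rewrite (psd_zero_diag N 0 j) // mul0r.
  exact: prodr_ge0.
pose a := N 0 0.
pose b : 'rV_n := @ursubmx R 1 n 1 n N.
pose D : 'M_n := @drsubmx R 1 n 1 n N.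
have bT : @dlsubmx R 1 n 1 n N = b^T by rewrite /b trmx_ursub sym.
have aE : @ulsubmx R 1 n 1 n N = a%:M.
  by apply/matrixP => i j; rewrite !ord1 !mxE /= mulr1n; congr (N _ _); apply/val_inj.
have NE : N = block_mx a%:M b b^T D :> 'M_(1 + n) by rewrite -aE -bT submxK.
pose D' := D - a^-1 *: (b^T *m b).
(* [P] holds the lower rows of the elimination matrix; [D' = P N P^T] makes semidefiniteness
   evident. *)
pose P : 'M_(n, 1 + n) := row_mx (- a^-1 *: b^T) 1%:M.
have PN : P *m (N : 'M_(1 + n)) = row_mx (0 : 'cV_n) D'.
  rewrite NE /P (mul_row_block _ _ a%:M) mul_mx_scalar scalerA mulrN mulfV //.
  rewrite scaleN1r !mul1mx addNr.
  by rewrite -scalemxAl scaleNr addrC.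
have D'E : D' = P *m (N : 'M_(1 + n)) *m P^T.
  by rewrite PN /P tr_row_mx mul_row_col mul0mx add0r trmx1 mulmx1.
have D'sym : D'^T = D' by rewrite D'E !trmx_mul trmxK sym mulmxA.
have D'psd (u : 'rV_n) : 0 <= (u *m D' *m u^T) 0 0.
  by have := psd (u *m P : 'rV_(1 + n)); rewrite trmx_mul !mulmxA D'E !mulmxA.
have detN : \det N = a * \det D'.
  have := det_lblock (1%:M : 'M[R]_1) (- a^-1 *: b^T) (1%:M : 'M[R]_n).
  rewrite !det1 mulr1 => detL; rewrite -[LHS]mul1r -detL -[in LHS]det_mulmx.
  rewrite block_mxEv mul_col_mx -/P PN.
  rewrite NE mul_row_block !mul1mx !mul0mx !addr0 -block_mxEv.
  by rewrite (det_ublock a%:M) det_scalar1.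
rewrite detN big_ord_recl ler_wpM2l ?d0 //.
apply: le_trans (IH _ D'sym D'psd) _; apply: ler_prod => i _.
rewrite psd_diag_ge0 //= !mxE big_ord1 !mxE.
have -> : lift ord0 i = rshift 1 i :> 'I_(1 + n) by apply/val_inj.
rewrite gerBl mulr_ge0 ?invr_ge0 ?d0 // -expr2; exact: sqr_ge0.
Qed.

Lemma det_le_trace {R : realFieldType} {n : nat} (N : 'M[R]_n) :
  N^T = N -> (forall u : 'rV_n, 0 <= (u *m N *m u^T) 0 0) ->
  \det N <= (\tr N / n%:R) ^+ n.
Proof.
move=> sym psd; apply: le_trans (hadamard N sym psd) _.
have [+ _] := @leif_AGM R 'I_n predT (fun i => N i i) (fun i _ => psd_diag_ge0 N psd i).
by rewrite card_ord /mxtrace.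
Qed.

Lemma sum_rank1_psd {R : realFieldType} {n m : nat} (w : 'I_m -> R) (v : 'I_m -> 'cV[R]_n) :
  (forall i, 0 <= w i) -> let N := \sum_i w i *: (v i *m (v i)^T) in
  N^T = N /\ forall u : 'rV_n, 0 <= (u *m N *m u^T) 0 0.
Proof.
move=> w0 /=; split.
  rewrite raddf_sum /=; apply: eq_bigr => i _.
  by rewrite linearZ /= trmx_mul trmxK.
move=> u; rewrite mulmx_sumr mulmx_suml summxE; apply: sumr_ge0 => i _.
rewrite -scalemxAr -scalemxAl mxE mulr_ge0 //.
have -> : u *m (v i *m (v i)^T) *m u^T = (u *m v i) *m (u *m v i)^T.
  by rewrite trmx_mul !mulmxA.
by rewrite mxE big_ord1 !mxE -expr2 sqr_ge0.
Qed.

(** The trace is a weighted mean of the squared norms, hence at most 1. *)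
Lemma det_sum_rank1_le {R : realFieldType} {n m : nat} (w : 'I_m -> R) (v : 'I_m -> 'cV[R]_n) :
  (0 < n)%N -> (forall i, 0 <= w i) -> \sum_i w i = 1 ->
  (forall i, \sum_l v i l 0 ^+ 2 <= 1) ->
  \det (\sum_i w i *: (v i *m (v i)^T)) <= n%:R^-1 ^+ n.
Proof.
move=> n0 w0 w1 v1; have [sym psd] := sum_rank1_psd w v w0.
apply: le_trans (det_le_trace _ sym psd) _.
have trE : \tr (\sum_i w i *: (v i *m (v i)^T)) = \sum_i w i * \sum_l v i l 0 ^+ 2.
  rewrite raddf_sum /=; apply: eq_bigr => i _; rewrite mxtraceZ; congr (_ * _).
  by apply: eq_bigr => l _; rewrite mxE big_ord1 mxE expr2.
have n0' : 0 < n%:R^-1 :> R by rewrite invr_gt0 ltr0n.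
rewrite lerXn2r ?nnegrE ?(ltW n0') //; last first.
  rewrite ler_piMl ?(ltW n0') // trE -w1; apply: ler_sum => i _.
  by rewrite ler_piMr.
rewrite mulr_ge0 ?(ltW n0') // trE; apply: sumr_ge0 => i _.
by rewrite mulr_ge0 // sumr_ge0 // => l _; exact: sqr_ge0.
Qed.

(** * The information matrix in Lagrange coordinates *)

Lemma lag_eq0 {R : comPzRingType} {I : finType} (y : I -> R) m (D S : {set I}) :
  (m <= #|S|)%N -> lag y m D S = 0.
Proof.
move=> mS; rewrite /lag big_pred0 // => U; apply/negP => /and3P[_ SU Um].
by move: (leq_ltn_trans (subset_leq_card SU) Um); rewrite ltnNge mS.
Qed.

Lemma sum_term {V : nmodType} {k : nat} (F : {set 'I_k} -> V) :
  \sum_(j < npar k) F (term j) = \sum_(S : {set 'I_k} | (#|S| <= 3)%N) F S.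
Proof.
rewrite -(@big_enum_val V _ _ (Idx k) predT (fun s => F (val s))) /=.
have s0 : (#|set0 : {set 'I_k}| <= 3)%N by rewrite cards0.
rewrite [RHS](reindex_onto val (insubd (exist _ set0 s0 : Idx k))) /=; last first.
  by move=> S S3; rewrite insubdK.
by apply: eq_bigl => S; rewrite valKd eqxx andbT (valP S).
Qed.

Lemma card_term {k : nat} (j : 'I_(npar k)) : (#|term j| <= 3)%N.
Proof. exact: valP (enum_val j). Qed.

Lemma term_inj {k : nat} : injective (@term k).
Proof. by move=> i j /val_inj /enum_val_inj. Qed.

(* The columns are [sqrt (lambda x_S) f(x_S)]. *)
Definition design_root (R : realType) (k : nat) : 'M[R]_(npar k) :=
  \matrix_(j, l) (fvec (dpt (design6 R k) l) j 0 * expR (- #|term l|%:R)).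

(** The argument is [x / 2] because the settings are [2 1_S]; the factor [e^|S|] undoes the root
    intensity in the columns of [design_root]. *)
Definition lagvec {R : realType} {k : nat} (x : 'rV[R]_k) : 'cV[R]_(npar k) :=
  \col_l (expR #|term l|%:R * lag ((2^-1 *: x) 0) 4 setT (term l)).

Lemma fvec_root {R : realType} {k : nat} (x : 'rV[R]_k) :
  fvec x = design_root R k *m lagvec x.
Proof.
apply/colP => j; rewrite !mxE; set y := (2^-1 *: x) 0.
transitivity (\sum_(S : {set 'I_k} | (#|S| <= 3)%N)
    ((\prod_(i in term j) (if i \in S then 2 else 0)) * lag y 4 setT S)).
  have c2 (S : {set 'I_k}) : \prod_(i in term j) (if i \in S then 2 else 0) =
      if term j \subset S then 2 ^+ #|term j| else 0 :> R.
    case: ifPn => [TS|/subsetPn[i iT iS]].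
      by rewrite -prodr_const; apply: eq_bigr => i iT; rewrite (subsetP TS).
    by rewrite (bigD1 i) //= (negbTE iS) mul0r.
  transitivity (2 ^+ #|term j| *
    \sum_(S : {set 'I_k} | (S \subset setT) && (term j \subset S)) lag y 4 setT S).
    rewrite sum_lag ?subsetT // ltnS card_term -prodr_const -big_split /=.
    by apply: eq_bigr => i _; rewrite /y mxE; field.
  (* Sets with more than three elements may be added or dropped, as their Lagrange polynomials
     vanish. *)
  rewrite mulr_sumr big_mkcond [RHS]big_mkcond; apply: eq_bigr => S _.
  rewrite subsetT c2 /=; case: leqP => [_|S4]; case: ifP => // _; rewrite ?mul0r //.
  by rewrite lag_eq0 ?mulr0.
rewrite -sum_term; apply: eq_bigr => l _.
rewrite !mxE -mulrA (mulrA (expR _)) -expRD addNr expR0 mul1r.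
by congr (_ * _); apply: eq_bigr => i _; rewrite mxE.
Qed.

Lemma intensity6 {R : realType} {k : nat} (x : 'rV[R]_k) :
  intensity (beta6 R k) x = expR (- \sum_i x 0 i).
Proof.
rewrite /intensity mxE; congr expR.
transitivity (\sum_(S : {set 'I_k} | (#|S| <= 3)%N)
    ((\prod_(i in S) x 0 i) * (if #|S| == 1%N then -1 else 0))).
  by rewrite -sum_term; apply: eq_bigr => j _; rewrite !mxE.
rewrite (bigID (fun S : {set 'I_k} => #|S| == 1%N)) /= [X in _ + X]big1 ?addr0; last first.
  by move=> S /andP[_ /negbTE ->]; rewrite mulr0.
rewrite (eq_bigl (mem [set [set i] | i in 'I_k])) => [|S]; last first.
  apply/andP/imsetP => [[_ /cards1P[i ->]]|[i _ ->]]; last by rewrite cards1.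
  by exists i.
rewrite big_imset /=; last by move=> i j _ _; exact: set1_inj.
by rewrite -sumrN; apply: eq_bigr => i _; rewrite big_set1 cards1 eqxx mulrN1.
Qed.

Lemma infomat6 {R : realType} {k : nat} :
  infomat (beta6 R k) (design6 R k) =
  (npar k)%:R^-1 *: (design_root R k *m (design_root R k)^T).
Proof.
apply/matrixP => i j; rewrite summxE !mxE mulr_sumr; apply: eq_bigr => l _.
rewrite !mxE big_ord1 intensity6 mxE 2!mxE.
set fi := \prod_(_ in _) _; set fj := \prod_(_ in _) _.
have -> : expR (- \sum_i (dpt (design6 R k) l) 0 i) = expR (- #|term l|%:R) * expR (- #|term l|%:R).
  rewrite -expRD; congr expR; rewrite -opprD; congr (- _).
  under eq_bigr do rewrite mxE.
  by rewrite -big_mkcond /= sumr_const -mulr_natr; ring.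
rewrite /=; ring.
Qed.

(** The scalar is the root of the intensity, so [design_root] maps this vector to
    [sqrt (lambda x) f(x)]. *)
Definition root_vec {R : realType} {k : nat} (x : 'rV[R]_k) : 'cV[R]_(npar k) :=
  expR (- (\sum_i x 0 i) / 2) *: lagvec x.

Lemma infomat_root {R : realType} {k : nat} (xi : design R k) :
  infomat (beta6 R k) xi =
  design_root R k *m
    (\sum_i dw xi i *: (root_vec (dpt xi i) *m (root_vec (dpt xi i))^T)) *m
    (design_root R k)^T.
Proof.
rewrite mulmx_sumr mulmx_suml; apply: eq_bigr => i _.
rewrite -scalemxAr -scalemxAl -scalerA; congr (_ *: _).
rewrite fvec_root intensity6 trmx_mul /root_vec [(_ *: lagvec _)^T]linearZ /=.
rewrite !(=^~ scalemxAl, =^~ scalemxAr) scalerA -expRD !mulmxA.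
by congr (expR _ *: _); field.
Qed.

(* The sensitivity condition of the equivalence theorem. *)
Lemma root_vec_norm {R : realType} {k : nat} (x : 'rV[R]_k) : nonneg_orthant x ->
  \sum_l root_vec x l 0 ^+ 2 <= 1.
Proof.
move=> x0.
have -> : \sum_l root_vec x l 0 ^+ 2 =
    expR (- \sum_i x 0 i) * gram (expR 2) ((2^-1 *: x) 0) 4 4 setT.
  set y := (2^-1 *: x) 0.
  transitivity (\sum_(S : {set 'I_k} | (#|S| <= 3)%N)
      expR (- \sum_i x 0 i) * (expR 2 ^+ #|S| * lag y 4 setT S * lag y 4 setT S)).
    rewrite -sum_term; apply: eq_bigr => l _; rewrite !mxE -/y.
    rewrite !exprMn -!expRM_natl -!mulrA -expr2 mulrA -expRD mulrA -expRD.
    by congr (expR _ * _); field.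
  rewrite -mulr_sumr; congr (_ * _); rewrite /gram big_mkcond [RHS]big_mkcond.
  apply: eq_bigr => S _; rewrite subsetT; case: leqP => // S4.
  by rewrite lag_eq0 // mulr0.
have y0 i : 0 <= (2^-1 *: x) 0 i by rewrite mxE mulr_ge0 ?invr_ge0 //; exact: x0.
rewrite mulrC expRN ler_pdivrMr ?expR_gt0 // mul1r.
apply: le_trans (gram_le_expR _ y0) _; rewrite ler_expR mulr_sumr.
by apply: ler_sum => i _; rewrite mxE; lra.
Qed.

Theorem theorem6 (R : realType) (k : nat) (hk : (3 <= k)%N) :
  locally_D_optimal (beta6 R k) (@nonneg_orthant R k) (design6 R k).
Proof.
have p0 : (0 < npar k)%N.
  apply/card_gt0P; have s0 : (#|set0 : {set 'I_k}| <= 3)%N by rewrite cards0.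
  by exists (exist _ set0 s0).
have p0' : (npar k)%:R != 0 :> R by rewrite pnatr_eq0 -lt0n.
split=> [|xi [_ w0 w1 xX]].
  split=> /= [i j /rowP ij|_||i l].
  - apply: term_inj; apply/setP => l; have := ij l; rewrite !mxE.
    by case: (l \in term i); case: (l \in term j) => // /eqP; rewrite ?(eq_sym 0) pnatr_eq0.
  - by rewrite invr_ge0.
  - by rewrite sumr_const card_ord -[_ *+ _]mulr_natr mulVf.
  - by rewrite mxE; case: ifP.
(* Both determinants contain the square of [\det (design_root R k)]; its nonnegativity is enough to
   compare the other factors. *)
rewrite infomat6 infomat_root !det_mulmx detZ det_tr det_mulmx det_tr.
rewrite [leLHS]mulrAC mulrC ler_wpM2r //; first by rewrite -expr2 sqr_ge0.
apply: det_sum_rank1_le => // i; exact: root_vec_norm.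
Qed.
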